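(* A triple $x=(x_1,x_2,x_3)$ of distinct points of $\partial H^n_{\mathbb{H}}$ lies in the ideal boundary of a quaternionic line ($\mathbb{H}$-line) of $H^n_{\mathbb{H}}$ if and only if $\mathbb{A}_{\mathbb{H}}(x)=\pi/2$.
   Context: $H^n_{\mathbb{H}}$ is the set of negative lines in the left $\mathbb{H}$-vector space $\mathbb{H}^{n+1}$ with Hermitian form $\langle z,w\rangle=\sum_{i=1}^n z_i\bar w_i-z_{n+1}\bar w_{n+1}$, and $\partial H^n_{\mathbb{H}}$ the set of null lines. An $\mathbb{H}$-line is a totally geodesic copy of $H^1_{\mathbb{H}}$ (projectivization of a 2-dimensional $\mathbb{H}$-subspace of signature $(1,1)$). For distinct points with lifts $\tilde x_i$, the triple product is $\langle\tilde x_1,\tilde x_2\rangle\langle\tilde x_2,\tilde x_3\rangle\langle\tilde x_3,\tilde x_1\rangle\in\mathbb{H}$, and $\mathbb{A}_{\mathbb{H}}(x)\in[0,\pi/2]$ is the angle in $\mathbb{H}\cong\mathbb{R}^4$ between $\mathbb{R}\cdot1$ and the triple product. *)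

(* Defs.v *)
From mathcomp Require Import all_boot all_order all_algebra.
From mathcomp Require Import all_classical all_reals all_analysis.
Set Implicit Arguments. Unset Strict Implicit. Unset Printing Implicit Defensive.
Import Order.TTheory GRing.Theory Num.Theory.
Local Open Scope ring_scope.

Record quat (R : realType) := Quat { qre : R; qi : R; qj : R; qk : R }.

Section Quat.
Variable R : realType.
Definition qzero : quat R := Quat 0 0 0 0.
Definition qone : quat R := Quat 1 0 0 0.
Definition qadd (p q : quat R) : quat R :=
  Quat (qre p + qre q) (qi p + qi q) (qj p + qj q) (qk p + qk q).
Definition qopp (p : quat R) : quat R := Quat (- qre p) (- qi p) (- qj p) (- qk p).
Definition qmul (p q : quat R) : quat R :=
  Quat (qre p * qre q - qi p * qi q - qj p * qj q - qk p * qk q)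
       (qre p * qi q + qi p * qre q + qj p * qk q - qk p * qj q)
       (qre p * qj q - qi p * qk q + qj p * qre q + qk p * qi q)
       (qre p * qk q + qi p * qj q - qj p * qi q + qk p * qre q).
Definition qconj (p : quat R) : quat R := Quat (qre p) (- qi p) (- qj p) (- qk p).
Definition qnorm2 (p : quat R) : R :=
  qre p ^+ 2 + qi p ^+ 2 + qj p ^+ 2 + qk p ^+ 2.
End Quat.

(* Vectors of the left H-vector space H^{n+1}; coordinate ord_max is the
   (n+1)-st, "negative" coordinate. *)
Definition qvec (R : realType) (n : nat) := 'I_n.+1 -> quat R.

Definition qvzero (R : realType) (n : nat) : qvec R n := fun _ => qzero R.
Definition qvscale (R : realType) (n : nat) (l : quat R) (z : qvec R n) : qvec R n :=
  fun i => qmul l (z i).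
Definition qvadd (R : realType) (n : nat) (z w : qvec R n) : qvec R n :=
  fun i => qadd (z i) (w i).

Definition herm (R : realType) (n : nat) (z w : qvec R n) : quat R :=
  qadd (\big[@qadd R/qzero R]_(i < n.+1 | i != ord_max) qmul (z i) (qconj (w i)))
       (qopp (qmul (z ord_max) (qconj (w ord_max)))).

(* z is a lift of a point of the boundary: a nonzero null vector *)
Definition null_vec (R : realType) (n : nat) (z : qvec R n) : Prop :=
  z <> @qvzero R n /\ herm z z = qzero R.

(* z and w span the same H-line of H^{n+1} (for nonzero z, w) *)
Definition same_qline (R : realType) (n : nat) (z w : qvec R n) : Prop :=
  exists l : quat R, z = qvscale l w.

Definition triple_prod (R : realType) (n : nat) (x1 x2 x3 : qvec R n) : quat R :=
  qmul (qmul (herm x1 x2) (herm x2 x3)) (herm x3 x1).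

Definition angle_to_real_line (R : realType) (t : quat R) : R :=
  acos (`|qre t| / Num.sqrt (qnorm2 t)).

Definition cartan_angle (R : realType) (n : nat) (x1 x2 x3 : qvec R n) : R :=
  angle_to_real_line (triple_prod x1 x2 x3).

(* The points with lifts x1,x2,x3 lie in the ideal boundary of an H-line:
   there is a 2-dimensional left H-subspace V of signature (1,1) (given by
   a basis e1, e2 with <e1,e1> = 1, <e2,e2> = -1, <e1,e2> = 0) containing
   the lifts x1, x2, x3 (null lines of V = ideal boundary of P(V)). *)
Definition in_qspan2 (R : realType) (n : nat) (e1 e2 x : qvec R n) : Prop :=
  exists a b : quat R, x = qvadd (qvscale a e1) (qvscale b e2).

Definition in_boundary_of_Hline (R : realType) (n : nat) (x1 x2 x3 : qvec R n) : Prop :=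
  exists e1 e2 : qvec R n,
    [/\ herm e1 e1 = qone R, herm e2 e2 = qopp (qone R), herm e1 e2 = qzero R &
        [/\ in_qspan2 e1 e2 x1, in_qspan2 e1 e2 x2 & in_qspan2 e1 e2 x3]].

(* Main.v *)
(** If [<x1,x2> <> 0], write [x3 = u + v] with [u] in the span of [x1], [x2]
    and [v] orthogonal to it. For null [xi] one finds
    [<v,v> = - 2 Re T / |<x1,x2>|^2], where [T] is the triple product. A null
    vector orthogonal to the null vectors [x1] and [x2] vanishes, so [Re T = 0]
    puts [x3] in the span of [x1] and [x2], a plane of signature (1,1).
    Conversely, for [xi = ai e1 + bi e2] the relations [|ai| = |bi|] make
    [Re T] vanish identically. *)
Require Import Defs.
From HB Require Import structures.
From mathcomp Require Import all_boot all_order all_algebra.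
From mathcomp Require Import all_classical all_reals all_analysis.
From mathcomp Require Import ring lra.
Set Implicit Arguments. Unset Strict Implicit. Unset Printing Implicit Defensive.
Import Order.TTheory GRing.Theory Num.Theory.
Local Open Scope ring_scope.

(** * The quaternions as a ring with conjugation and norm *)

Lemma quatP (R : realType) (p q : quat R) :
  qre p = qre q -> qi p = qi q -> qj p = qj q -> qk p = qk q -> p = q.
Proof. by case: p q => [????] [????] /= -> -> -> ->. Qed.

HB.instance Definition _ (R : realType) := gen_eqMixin (quat R).
HB.instance Definition _ (R : realType) := gen_choiceMixin (quat R).

Section QuatRing.
Variable R : realType.
Implicit Types p q r : quat R.

Fact qaddA : associative (@qadd R).
Proof. by move=> p q r; apply: quatP => /=; ring. Qed.
Fact qaddC : commutative (@qadd R).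
Proof. by move=> p q; apply: quatP => /=; ring. Qed.
Fact qadd0 : left_id (qzero R) (@qadd R).
Proof. by move=> p; apply: quatP => /=; ring. Qed.
Fact qaddN : left_inverse (qzero R) (@qopp R) (@qadd R).
Proof. by move=> p; apply: quatP => /=; ring. Qed.

HB.instance Definition _ := GRing.isZmodule.Build (quat R) qaddA qaddC qadd0 qaddN.

Fact qmulA : associative (@qmul R).
Proof. by move=> p q r; apply: quatP => /=; ring. Qed.
Fact qmul1 : left_id (qone R) (@qmul R).
Proof. by move=> p; apply: quatP => /=; ring. Qed.
Fact qmulr1 : right_id (qone R) (@qmul R).
Proof. by move=> p; apply: quatP => /=; ring. Qed.
Fact qmulDl : left_distributive (@qmul R) (@qadd R).
Proof. by move=> p q r; apply: quatP => /=; ring. Qed.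
Fact qmulDr : right_distributive (@qmul R) (@qadd R).
Proof. by move=> p q r; apply: quatP => /=; ring. Qed.
Fact qone_neq0 : qone R != qzero R.
Proof. by apply/eqP => -[] /eqP; rewrite oner_eq0. Qed.

HB.instance Definition _ := GRing.Zmodule_isNzRing.Build (quat R)
  qmulA qmul1 qmulr1 qmulDl qmulDr qone_neq0.

Lemma qconjK : involutive (@qconj R).
Proof. by move=> p; apply: quatP => /=; ring. Qed.
Lemma qconjB p q : qconj (p - q) = qconj p - qconj q.
Proof. by apply: quatP => /=; ring. Qed.
Lemma qconjD p q : qconj (p + q) = qconj p + qconj q.
Proof. by apply: quatP => /=; ring. Qed.
Lemma qconjM p q : qconj (p * q) = qconj q * qconj p.
Proof. by apply: quatP => /=; ring. Qed.
Lemma qconj0 : qconj 0 = 0 :> quat R.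
Proof. by apply: quatP => /=; ring. Qed.

Lemma qconj1 : qconj 1 = 1 :> quat R.
Proof. by apply: quatP => /=; ring. Qed.
Lemma qconjN p : qconj (- p) = - qconj p.
Proof. by []. Qed.

Lemma qre0 : qre (0 : quat R) = 0. Proof. by []. Qed.
Lemma qreD p q : qre (p + q) = qre p + qre q. Proof. by []. Qed.
Lemma qreN p : qre (- p) = - qre p. Proof. by []. Qed.
Lemma qre_conj p : qre (qconj p) = qre p. Proof. by []. Qed.

Lemma qnorm2M p q : qnorm2 (p * q) = qnorm2 p * qnorm2 q.
Proof. by rewrite /qnorm2 /=; ring. Qed.

Lemma qre_mul_conj p : qre (p * qconj p) = qnorm2 p.
Proof. by rewrite /qnorm2 /=; ring. Qed.

Lemma qnorm2_conj p : qnorm2 (qconj p) = qnorm2 p.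
Proof. by rewrite /qnorm2 /= !sqrrN. Qed.

Lemma qnorm2_ge0 p : 0 <= qnorm2 p.
Proof. by rewrite /qnorm2 !addr_ge0 // sqr_ge0. Qed.

Lemma qnorm2_eq0 p : (qnorm2 p == 0) = (p == 0).
Proof.
apply/idP/eqP => [|->]; last by rewrite /qnorm2 /= expr0n /= !addr0.
rewrite /qnorm2 !paddr_eq0 ?addr_ge0 ?sqr_ge0 // !sqrf_eq0.
by case/andP => /andP[/andP[/eqP ? /eqP ?] /eqP ?] /eqP ?; apply: quatP.
Qed.

(** Meant for [<v,v>], which conjugation fixes, so that only its real part has to be computed. *)
Lemma qself_conj_eq0 p : qconj p = p -> qre p = 0 -> p = 0.
Proof. by case: p => a b c d [] /= *; apply: quatP => /=; lra. Qed.

Definition qinv p : quat R :=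
  Quat (qre p / qnorm2 p) (- qi p / qnorm2 p) (- qj p / qnorm2 p) (- qk p / qnorm2 p).

Lemma qmulV p : p != 0 -> p * qinv p = 1.
Proof.
rewrite -qnorm2_eq0 /qnorm2 => p0.
by apply: quatP => /=; rewrite /qnorm2; field.
Qed.

Lemma qmulVl p : p != 0 -> qinv p * p = 1.
Proof.
rewrite -qnorm2_eq0 /qnorm2 => p0.
by apply: quatP => /=; rewrite /qnorm2; field.
Qed.

(** Since [qinv p] is [qconj p] over [qnorm2 p], the left product is the conjugate of [r * p * q]
    over [qnorm2 p]; the real part is invariant under conjugation and cyclic permutation. *)
Lemma qre_mul_inv p q r : p != 0 ->
  qre (qconj q * qinv p * qconj r) = qre (p * q * r) / qnorm2 p.
Proof. by rewrite -qnorm2_eq0 /qnorm2 => p0 /=; rewrite /qnorm2; field. Qed.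

(** Of the eight terms of the expansion, the six mixed ones pair up, by conjugation and cyclic
    permutation under the real part, each pair carrying a factor such as [qnorm2 a1 - qnorm2 b1].
    The two pure terms give the difference of the products of norms. *)
Lemma qre_triple a1 a2 a3 b1 b2 b3 :
  qnorm2 a1 = qnorm2 b1 -> qnorm2 a2 = qnorm2 b2 -> qnorm2 a3 = qnorm2 b3 ->
  qre ((a1 * qconj a2 - b1 * qconj b2) * (a2 * qconj a3 - b2 * qconj b3) *
       (a3 * qconj a1 - b3 * qconj b1)) = 0.
Proof.
move=> h1 h2 h3.
transitivity (qnorm2 a1 * qnorm2 a2 * qnorm2 a3 - qnorm2 b1 * qnorm2 b2 * qnorm2 b3
  - (qnorm2 a3 - qnorm2 b3) * qre (a1 * qconj a2 * b2 * qconj b1)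
  - (qnorm2 a1 - qnorm2 b1) * qre (a2 * qconj a3 * b3 * qconj b2)
  - (qnorm2 a2 - qnorm2 b2) * qre (a3 * qconj a1 * b1 * qconj b3)).
  by rewrite /qnorm2 /=; ring.
by rewrite h1 h2 h3; ring.
Qed.

End QuatRing.

(** * The Hermitian form, its null vectors and its hyperbolic planes *)

Section Hermitian.
Variables (R : realType) (n : nat).
Implicit Types (x y z w e : qvec R n) (l a b : quat R).

(** Holds by conversion, since the ring structure is built on [qadd], [qopp] and [qmul]; from here
    on the general lemmas on sums in rings apply. *)
Lemma hermE z w : herm z w =
  \sum_(i < n.+1 | i != ord_max) z i * qconj (w i) - z ord_max * qconj (w ord_max).
Proof. by []. Qed.

Lemma hermC z w : herm w z = qconj (herm z w).
Proof.
rewrite !hermE qconjB qconjM qconjK (big_morph _ (@qconjD R) (@qconj0 R)).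
by congr (_ - _); apply: eq_bigr => i _; rewrite qconjM qconjK.
Qed.

Lemma hermDl x y w : herm (qvadd x y) w = herm x w + herm y w.
Proof.
rewrite !hermE /qvadd (_ : qadd _ _ = x ord_max + y ord_max) // mulrDl opprD addrACA.
by rewrite -big_split /=; congr (_ + _); apply: eq_bigr => i _; rewrite -mulrDl.
Qed.

Lemma hermZl l z w : herm (qvscale l z) w = l * herm z w.
Proof.
rewrite !hermE mulrBr mulr_sumr; congr (_ - _); last by rewrite mulrA.
by apply: eq_bigr => i _; rewrite mulrA.
Qed.

Lemma hermDr x y w : herm w (qvadd x y) = herm w x + herm w y.
Proof. by rewrite hermC hermDl qconjD -!hermC. Qed.

Lemma hermZr l z w : herm z (qvscale l w) = herm z w * qconj l.
Proof. by rewrite hermC hermZl qconjM -hermC. Qed.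

Definition hermL := (hermDl, hermDr, hermZl, hermZr).

(** On the hyperplane [z ord_max = 0] the form is positive definite: the real part of [<z,z>] is the
    sum of the norms of the other coordinates. *)
Lemma qvec_eq0 z : herm z z = 0 -> z ord_max = 0 -> z = @qvzero R n.
Proof.
move=> zz z0; apply/funext => i; have [-> //|i_max] := eqVneq i ord_max.
have : qre (herm z z) = 0 by rewrite zz.
rewrite hermE z0 mul0r subr0 (big_morph (@qre R) (@qreD R) (@qre0 R)).
under eq_bigr do rewrite qre_mul_conj.
move/eqP; rewrite psumr_eq0 => [/allP/(_ i (mem_index_enum i))|j _].
  by rewrite i_max qnorm2_eq0 => /eqP.
exact: qnorm2_ge0.
Qed.

(* Subtracting a multiple of [x] kills the negative coordinate of [v], and the
   difference is still null. *)
Lemma null_orthogonal_collinear v x :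
  null_vec x -> herm v v = 0 -> herm v x = 0 -> same_qline v x.
Proof.
move=> [x_neq0 xx] vv vx.
have xm : x ord_max != 0 by apply/eqP => xm; apply/x_neq0/qvec_eq0.
have xv : herm x v = 0 by rewrite hermC vx qconj0.
pose l := v ord_max * qinv (x ord_max); exists l.
have : qvadd v (qvscale (- l) x) = @qvzero R n.
  apply: qvec_eq0; first by rewrite !hermL vv vx xv xx !(mul0r, mulr0, addr0).
  change (v ord_max + - l * x ord_max = 0).
  by rewrite /l mulNr -mulrA qmulVl // mulr1 subrr.
move=> e; apply/funext => i; move: (congr1 (@^~ i) e).
change (v i + - l * x i = 0 -> v i = l * x i).
by rewrite mulNr => /eqP; rewrite subr_eq0 => /eqP.
Qed.

Lemma herm_neq0 x y : null_vec x -> null_vec y -> ~ same_qline x y -> herm x y != 0.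
Proof.
by move=> [_ xx] ny; apply: contra_not_neq => xy; apply: null_orthogonal_collinear.
Qed.

Lemma herm_orthonormal e1 e2 a b a' b' :
  herm e1 e1 = 1 -> herm e2 e2 = -1 -> herm e1 e2 = 0 ->
  herm (qvadd (qvscale a e1) (qvscale b e2)) (qvadd (qvscale a' e1) (qvscale b' e2)) =
  a * qconj a' - b * qconj b'.
Proof.
move=> h1 h2 h12; have h21 : herm e2 e1 = 0 by rewrite hermC h12 qconj0.
by rewrite !hermL h1 h2 h12 h21 !(mulr0, mul0r, mul1r, addr0, add0r) mulN1r mulrN.
Qed.

Lemma in_boundary_qre_triple x1 x2 x3 :
  herm x1 x1 = 0 -> herm x2 x2 = 0 -> herm x3 x3 = 0 ->
  in_boundary_of_Hline x1 x2 x3 -> qre (triple_prod x1 x2 x3) = 0.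
Proof.
move=> n1 n2 n3 [e1 [e2 [h1 h2 h12 [[a1 [b1 e]] [a2 [b2 e']] [a3 [b3 e'']]]]]].
subst x1 x2 x3; move: n1 n2 n3; rewrite /triple_prod !herm_orthonormal //.
have null a b : a * qconj a - b * qconj b = 0 -> qnorm2 a = qnorm2 b.
  by rewrite -!qre_mul_conj => /eqP; rewrite subr_eq0 => /eqP ->.
by move=> /null n1 /null n2 /null n3; apply: qre_triple.
Qed.

(** Two non-orthogonal null vectors span a hyperbolic plane; this produces the orthonormal basis
    that [in_boundary_of_Hline] asks for. *)
Lemma in_qspan2_null_basis x1 x2 :
  herm x1 x1 = 0 -> herm x2 x2 = 0 -> herm x1 x2 != 0 ->
  exists e1 e2, [/\ herm e1 e1 = 1, herm e2 e2 = -1, herm e1 e2 = 0 &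
    forall a b, in_qspan2 e1 e2 (qvadd (qvscale a x1) (qvscale b x2))].
Proof.
move=> n1 n2 a0; set a := herm x1 x2 in a0.
pose h : quat R := Quat (2^-1) 0 0 0.
have hh : h + h = 1 by apply: quatP => /=; field.
have hC (p : quat R) : p * h = h * p by apply: quatP => /=; ring.
have hconj : qconj h = h by apply: quatP => /=; ring.
(* [m] is chosen so that [<x1, m x2> = 1/2]; then [x1 + m x2] and [x1 - m x2]
   are orthogonal of norms 1 and -1. *)
pose m := qconj (qinv a * h).
have am : a * qconj m = h by rewrite qconjK mulrA qmulV // mul1r.
have ma : m * qconj a = h by rewrite -[m]qconjK -qconjM am.
have h21 : herm x2 x1 = qconj a by rewrite -hermC.
have m0 : m != 0.
  by apply: contra_neq a0 => m0; rewrite -[a]mulr1 -hh mulrDr hC -ma m0 !mul0r addr0.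
exists (qvadd x1 (qvscale m x2)), (qvadd x1 (qvscale (- m) x2)); split.
- by rewrite !hermL n1 n2 h21 -/a am ma !(mul0r, mulr0, addr0, add0r, oppr0).
- by rewrite !hermL n1 n2 h21 -/a qconjN mulrN mulNr am ma !(mul0r, mulr0, addr0, add0r, oppr0)
    -opprD hh.
- by rewrite !hermL n1 n2 h21 -/a qconjN mulrN am ma !(mul0r, mulr0, addr0, add0r) addrC subrr.
(* As [x1 = h (e1 + e2)] and [m x2 = h (e1 - e2)], the coordinates of [p x1 + q x2] in the new basis
   are [A] and [B]. *)
move=> p q; pose A := p * h + q * qinv m * h; pose B := p * h - q * qinv m * h.
have AB : A + B = p by rewrite addrACA subrr addr0 -mulrDr hh mulr1.
have ABm : (A - B) * m = q.
  by rewrite opprB addrC addrA subrK -mulrDr hh mulr1 -mulrA qmulVl // mulr1.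
exists A, B; apply/funext => i; clearbody A B; rewrite -{}AB -{}ABm.
change ((A + B) * x1 i + (A - B) * m * x2 i =
  A * (x1 i + m * x2 i) + B * (x1 i + - m * x2 i)).
by rewrite !(mulrDr, mulrDl, mulNr, mulrN, mulrA) addrACA.
Qed.

Lemma qre_triple_in_boundary x1 x2 x3 :
  null_vec x1 -> null_vec x2 -> null_vec x3 -> herm x1 x2 != 0 ->
  qre (triple_prod x1 x2 x3) = 0 -> in_boundary_of_Hline x1 x2 x3.
Proof.
move=> nx1 [_ n2] [_ n3] a0 T0; have [_ n1] := nx1; set a := herm x1 x2 in a0.
have [e1 [e2 [h1 h2 h12 span]]] := in_qspan2_null_basis n1 n2 a0.
(* The coefficients solve [<u,x2> = p a = <x3,x2>] and [<u,x1> = q (qconj a) = <x3,x1>], so [u] is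
   the orthogonal projection of [x3] to the span of [x1] and [x2]. *)
pose p := herm x3 x2 * qinv a; pose q := herm x3 x1 * qconj (qinv a).
pose u := qvadd (qvscale p x1) (qvscale q x2).
pose v := qvadd x3 (qvscale (-1) u).
have h21 : herm x2 x1 = qconj a by rewrite -hermC.
have v1 : herm v x1 = 0.
  by rewrite /v /u !hermL n1 h21 /q -mulrA -qconjM qmulV // qconj1 mulr0 add0r mulr1
    mulN1r subrr.
have v2 : herm v x2 = 0.
  by rewrite /v /u !hermL n2 -/a /p -mulrA qmulVl // mulr0 addr0 mulr1 mulN1r subrr.
have vv : herm v v = 0.
  apply: qself_conj_eq0; first by rewrite -hermC.
  (* Orthogonality reduces [<v,v>] to [<v,x3>], whose real part is minus that of
     [p <x1,x3> + q <x2,x3>]. These two summands are conjugate, with real part [Re T / |a|^2]. *)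
  rewrite {2}/v hermDr hermZr hermDr !hermZr v1 v2 !mul0r addr0 mul0r addr0.
  rewrite /v /u !hermL n3 add0r mulN1r qreN qreD.
  have p0 : qre (p * herm x1 x3) = 0.
    by rewrite /p (hermC x2 x3) (hermC x3 x1) qre_mul_inv // T0 mul0r.
  have -> : q * herm x2 x3 = qconj (p * herm x1 x3).
    by rewrite !qconjM -!hermC mulrA.
  by rewrite qre_conj p0 addr0 oppr0.
have v0 : v = @qvzero R n.
  (* Orthogonality to [x1] makes [v] a multiple [l x1]; pairing with [x2] then gives [l * a = 0]. *)
  have [l vl] := null_orthogonal_collinear nx1 vv v1.
  move: v2; rewrite vl hermZl -/a => la0.
  have -> : l = 0 by rewrite -[l]mulr1 -(qmulV a0) mulrA la0 mul0r.
  by apply/funext => i; apply: mul0r.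
have -> : x3 = u.
  apply/funext => i; move: (congr1 (@^~ i) v0); change (x3 i + -1 * u i = 0 -> x3 i = u i).
  by rewrite mulN1r => /eqP; rewrite subr_eq0 => /eqP.
exists e1, e2; split => //; split; last exact: span.
- suff -> : x1 = qvadd (qvscale 1 x1) (qvscale 0 x2) by exact: span.
  by apply/funext => i; change (x1 i = 1 * x1 i + 0 * x2 i); rewrite mul1r mul0r addr0.
- suff -> : x2 = qvadd (qvscale 0 x1) (qvscale 1 x2) by exact: span.
  by apply/funext => i; change (x2 i = 0 * x1 i + 1 * x2 i); rewrite mul1r mul0r add0r.
Qed.

End Hermitian.

(** * The angle condition as vanishing of the real part *)

Lemma angle_eq_pihalf (R : realType) (t : quat R) : t != 0 ->
  angle_to_real_line t = pi / 2 <-> qre t = 0.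
Proof.
rewrite -qnorm2_eq0 => t0; rewrite /angle_to_real_line.
have s0 : 0 < Num.sqrt (qnorm2 t) by rewrite sqrtr_gt0 lt0r t0 qnorm2_ge0.
split=> [|->]; last by rewrite normr0 mul0r acos0.
(* The bound [|Re t| <= |t|] keeps the quotient in the interval where [cos] undoes [acos]. *)
have le1 : `|qre t| / Num.sqrt (qnorm2 t) <= 1.
  rewrite ler_pdivrMr // mul1r -sqrtr_sqr ler_wsqrtr // /qnorm2 -!addrA lerDl.
  by rewrite !addr_ge0 // sqr_ge0.
move/(congr1 cos); rewrite cos_pihalf acosK; last first.
  by rewrite in_itv /= le1 andbT (le_trans (lerN10 _)) // divr_ge0 // ltW.
by move/eqP; rewrite mulf_eq0 invr_eq0 (gt_eqF s0) orbF normr_eq0 => /eqP.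
Qed.

Theorem theorem3p6 (R : realType) (n : nat) (x1 x2 x3 : qvec R n) :
  null_vec x1 -> null_vec x2 -> null_vec x3 ->
  ~ same_qline x1 x2 -> ~ same_qline x2 x3 -> ~ same_qline x1 x3 ->
  in_boundary_of_Hline x1 x2 x3 <-> cartan_angle x1 x2 x3 = pi / 2.
Proof.
move=> n1 n2 n3 d12 d23 d13.
have a12 := herm_neq0 n1 n2 d12; have a23 := herm_neq0 n2 n3 d23.
have a13 := herm_neq0 n1 n3 d13.
rewrite /cartan_angle angle_eq_pihalf; last first.
  (* The triple product is nonzero because the norm is multiplicative and no factor has norm zero;
     [<x3,x1>] is the conjugate of [<x1,x3>]. *)
  rewrite /triple_prod -!qnorm2_eq0 in a12 a23 a13 *.
  rewrite (hermC x1 x3) (qnorm2M (_ * _)) (qnorm2M (herm x1 x2)) qnorm2_conj.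
  by rewrite !mulf_neq0.
split; last exact: qre_triple_in_boundary.
by case: n1 n2 n3 => [_ ?] [_ ?] [_ ?]; apply: in_boundary_qre_triple.
Qed.
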